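(* Let $\mathcal{M}$ be a regular map whose orientation-preserving automorphism group $G=\mathrm{Aut}^+(\mathcal{M})=\langle R,L\rangle$ (with $L^2=1$) is nilpotent of class $c\ge 2$. Then $\mathcal{M}$ gives rise to the symmetric dessin $\mathcal{D}=(H,x,y)$ with $x=R$, $y=R^L=L^{-1}RL$ and $H=\langle x,y\rangle$, and $H\cong\mathrm{Aut}(\mathcal{D})$ is nilpotent of class at most $c-1$.
   Context: An (orientably) regular map $\mathcal{M}$ is described algebraically by its orientation-preserving automorphism group $G=\langle R,L\rangle$, a finite group generated by an element $R$ (rotation about a vertex) and an involution $L$ (reversing an edge). A regular dessin is a triple $(H,x,y)$ with $H$ a finite group generated by $x,y$; it is symmetric if $x\mapsto y$, $y\mapsto x$ extends to an automorphism of $H$. For a regular map with non-abelian nilpotent automorphism group the map is bipartite and $\langle R,R^L\rangle$ is the colour-preserving subgroup $\mathrm{Aut}_0^+(\mathcal{M})$. Nilpotency class: $G$ has class $c$ if its lower central series $G_1=G$, $G_{i+1}=[G_i,G]$ satisfies $G_{c+1}=1\ne G_c$. *)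

(* Defs.v *)
From HB Require Import structures.
From mathcomp Require Import all_boot all_fingroup all_solvable.

Set Implicit Arguments.
Unset Strict Implicit.
Unset Printing Implicit Defensive.

Import GroupScope.

(* A finite orientably regular map, given algebraically: [map_aut] is Aut^+(M),
   [map_R] a rotation about a vertex, [map_L] the reversal of an incident
   edge. *)
Record regular_map (gT : finGroupType) := RegularMap {
  map_aut : {group gT};
  map_R : gT;
  map_L : gT;
  map_autE : map_aut = <<[set map_R; map_L]>> :> {set gT};
  map_L_involution : #[map_L] = 2
}.

Record regular_dessin (gT : finGroupType) := RegularDessin {
  dessin_group : {group gT};
  dessin_x : gT;
  dessin_y : gT;
  dessin_groupE : dessin_group = <<[set dessin_x; dessin_y]>> :> {set gT}
}.

Definition symmetric_dessin (gT : finGroupType) (D : regular_dessin gT) : Prop :=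
  exists2 f : {perm gT}, f \in Aut (dessin_group D) &
    f (dessin_x D) = dessin_y D /\ f (dessin_y D) = dessin_x D.

(* The edges of the dessin (H, x, y) are the elements of H; x and y permute
   them, by right translation, as the rotations about the black and the white
   vertices. *)
Definition edge_rotation (gT : finGroupType) (H : {group gT}) (z : gT) :
    {perm subg_of H} :=
  actperm 'R (subg H z).

(* Automorphisms are the permutations of the edges that commute with both
   rotations. *)
Definition dessin_Aut (gT : finGroupType) (D : regular_dessin gT) :
    {group {perm subg_of (dessin_group D)}} :=
  'C([set edge_rotation (dessin_group D) (dessin_x D);
          edge_rotation (dessin_group D) (dessin_y D)])%G.

(* [R ^ L] is conjugation, L^-1 * (R * L). *)
Definition dessin_of_map (gT : finGroupType) (M : regular_map gT) :
    regular_dessin gT :=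
  @RegularDessin gT <<[set map_R M; map_R M ^ map_L M]>>%G
    (map_R M) (map_R M ^ map_L M) (erefl _).

(* Main.v *)
(** Modulo the third term of the lower central series of [G] the commutator
    [[R, L]] is central, so [R] and [R ^ L = R * [R, L]] commute there. Hence
    the derived subgroup of [H] lies one step deeper in the lower central series
    of [G] than expected, and this gain of one step persists along the series.
    The symmetry of the dessin is conjugation by [L], and the permutations
    commuting with all right translations are the left translations. *)
Require Import Defs.
From HB Require Import structures.
From mathcomp Require Import all_boot all_fingroup all_solvable.

Import GroupScope.

Section LeftTranslation.

Variable gT : finGroupType.

(** The inverse makes [ltrans] multiplicative, since permutations compose from left to right. *)
Definition ltrans (u : gT) : {perm gT} := perm (mulgI u^-1).

Lemma ltransE u v : ltrans u v = u^-1 * v.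
Proof. exact: permE. Qed.

Lemma ltrans_morphM : {in [set: gT] &, {morph ltrans : u v / u * v}}.
Proof.
by move=> u v _ _; apply/permP => w; rewrite permM !ltransE invMg mulgA.
Qed.

Definition ltrans_morphism := Morphism ltrans_morphM.

Lemma injm_ltrans : 'injm ltrans_morphism.
Proof.
apply/injmP => u v _ _ /= eq_uv; apply: invg_inj.
by rewrite -[u^-1]mulg1 -[v^-1]mulg1 -!ltransE eq_uv.
Qed.

(** Evaluating commutation at [1] gives [s u = s (1 * u) = s 1 * u], so [s] is determined by [s 1];
    the converse is associativity. *)
Lemma cent_rtrans :
  'C(actperm 'R @* [set: gT]) = ltrans_morphism @* [set: gT].
Proof.
apply/setP/subset_eqP/andP; split; apply/subsetP => s.
  move=> /centP cRs; have -> : s = ltrans_morphism (s 1)^-1.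
    apply/permP => u; rewrite ltransE invgK.
    have /cRs/permP/(_ 1) : actperm 'R u \in actperm 'R @* [set: gT].
      by rewrite mem_morphim ?inE.
    by rewrite !permM !actpermE /= mul1g.
  by rewrite mem_morphim ?inE.
case/morphimP=> u _ _ -> /=; apply/centP => t /morphimP[v _ _ ->].
by apply/permP => w; rewrite !permM !actpermE !ltransE /= mulgA.
Qed.

End LeftTranslation.

Lemma dessin_Aut_isog (gT : finGroupType) (D : regular_dessin gT) :
  dessin_group D \isog dessin_Aut D.
Proof.
set H := dessin_group D; set x := dessin_x D; set y := dessin_y D.
have sxyH : [set x; y] \subset H by rewrite [H : {set _}]dessin_groupE subset_gen.
have [Hx Hy] : x \in H /\ y \in H.
  by split; apply: (subsetP sxyH); rewrite !inE eqxx ?orbT.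
suff -> : dessin_Aut D = (ltrans_morphism (subg_of H) @* [set: subg_of H])%G.
  apply: (isog_trans (isog_subg H)).
  by apply: sub_isog (injm_ltrans _); rewrite subsetT.
(* As [x] and [y] generate [H], the two edge rotations generate all right translations, hence have
   the same centraliser. *)
apply/val_inj; rewrite /= -cent_rtrans -cent_gen; congr 'C(_).
have defT : [set: subg_of H] = <<[set subg H x; subg H y]>>.
  have <- : subg H @* H = [set: subg_of H] by exact: im_subg.
  rewrite {2}[H : {set _}]dessin_groupE morphim_gen //.
  by rewrite morphimU !morphim_set1.
by rewrite [X in _ = _ @* X]defT morphim_gen ?subsetT // morphimU !morphim_set1 ?inE.
Qed.

Section MapDessin.

Variables (gT : finGroupType) (M : regular_map gT).
Local Notation G := (map_aut M).
Local Notation R := (map_R M).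
Local Notation L := (map_L M).
Local Notation H := (dessin_group (dessin_of_map M)).

Lemma mem_map_R : R \in G.
Proof. by rewrite map_autE mem_gen // !inE eqxx. Qed.

Lemma mem_map_L : L \in G.
Proof. by rewrite map_autE mem_gen // !inE eqxx orbT. Qed.

Lemma dessin_of_map_sub : H \subset G.
Proof.
by rewrite gen_subG subUset !sub1set groupJ ?mem_map_R ?mem_map_L.
Qed.

Lemma map_R_conjLL : (R ^ L) ^ L = R.
Proof.
by rewrite -conjgM -expg2 -(map_L_involution M) expg_order conjg1.
Qed.

Lemma map_L_norm : L \in 'N(H).
Proof.
by rewrite inE -genJ gen_subG conjUg !conjg_set1 map_R_conjLL setUC subset_gen.
Qed.

Lemma dessin_of_map_symmetric : symmetric_dessin (dessin_of_map M).
Proof.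
exists (conj_aut H L); first exact: Aut_aut.
by split; rewrite norm_conj_autE ?map_L_norm ?map_R_conjLL //;
   apply: mem_gen; rewrite !inE eqxx ?orbT.
Qed.

Lemma dessin_of_map_der1 : [~: H, H] \subset 'L_3(G).
Proof.
have nLG := lcn_norm 3 G.
have nLH := subset_trans dessin_of_map_sub nLG.
have sxyH : [set R; R ^ L] \subset 'N('L_3(G)).
  by apply: subset_trans nLH; apply: subset_gen.
have RyL : [~ R, R ^ L] \in 'L_3(G).
  (* Substituting [R ^ L = R * [~ R, L]] leaves [[~ R, [~ R, L]]], the inverse of a generator of
     ['L_3(G)]. *)
  rewrite conjg_mulR commgMJ commgg conj1g mulg1 -invg_comm groupV.
  exact: mem_commg (mem_commg mem_map_R mem_map_L) mem_map_R.
have [nR ny] : R \in 'N('L_3(G)) /\ R ^ L \in 'N('L_3(G)).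
  by split; apply: (subsetP sxyH); rewrite !inE eqxx ?orbT.
have cRy : commute (coset 'L_3(G) R) (coset 'L_3(G) (R ^ L)).
  by apply/commgP; rewrite -morphR //; apply/eqP/coset_id.
(* It remains to see that [H / 'L_3(G)] is abelian, which is tested on its two generating cosets. *)
rewrite -quotient_cents2 // quotient_gen // -/(abelian _) abelian_gen.
rewrite quotientU !quotient_set1 // abelianE subUset !sub1set centU !inE.
by rewrite !cent_set1 !cent1id /= andbT; apply/andP; split; apply/cent1P.
Qed.

(** The gain starts at the second term, as [H] itself need not lie in ['L_2(G)]; commutation with
    [H \subset G] then preserves it. *)
Lemma dessin_of_map_lcn n : 'L_n.+2(H) \subset 'L_n.+3(G).
Proof.
elim: n => [|n IHn]; first by rewrite lcn2 dessin_of_map_der1.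
by rewrite lcnSn (lcnSn n.+2) commgSS // dessin_of_map_sub.
Qed.

End MapDessin.

Theorem theorem5p2 (gT : finGroupType) (M : regular_map gT) (c : nat)
    (hc : 2 <= c)
    (nilG : nilpotent (map_aut M)) (classG : nil_class (map_aut M) = c) :
  let D := dessin_of_map M in
  [/\ symmetric_dessin D,
      dessin_group D \isog dessin_Aut D,
      nilpotent (dessin_group D)
    & nil_class (dessin_group D) <= c - 1].
Proof.
have nilH := nilpotentS (dessin_of_map_sub _ M) nilG.
split=> //; [exact: dessin_of_map_symmetric | exact: dessin_Aut_isog |].
(* With [c = n.+2], the class of [G] gives ['L_n.+3(G) = 1], hence ['L_n.+2(H) = 1], which means
   class at most [n.+1]. *)
case: c hc classG => [|[|n]] // _ classG; rewrite subn1 /=.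
apply/(lcn_nil_classP _ nilH)/trivgP.
apply: subset_trans (dessin_of_map_lcn _ M n) _.
by apply/trivgP/(lcn_nil_classP _ nilG); rewrite classG.
Qed.
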